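(* Let $\mathbf{V}$ be a pseudovariety of semigroups. Then exactly one of the following holds. (a) The pseudovariety $\mathbf{V}$ has bounded diameter. In particular, $C^2_{\mathbf{V}}(N) \in \mathcal{O}(1)$. (b) The pseudovariety $\mathbf{V}$ requires straight-line programs of length $\Omega(\log N)$, i.e., $C^\infty_{\mathbf{V}}(N) \in \Omega(\log N)$. Moreover, (a) is the case if and only if $\mathbf{V} \subseteq \mathbf{RB} \circ \mathbf{N}_k$ for some $k \geq 1$, where $\mathbf{RB}\circ\mathbf{N}_k$ denotes the class of all finite semigroups $S$ whose ideal $S^k$ is a rectangular band.
   Context: A pseudovariety is a class of finite semigroups closed under finite direct products, subsemigroups, and homomorphic images. $S^k$ is the set (ideal) of all products of $k$ elements of $S$. A rectangular band is a semigroup satisfying $x^2 = x$ and $xyz = xz$. (The class written here $\mathbf{RB}\circ\mathbf{N}_k$ is the Mal'cev product of $\mathbf{RB}$, the finite rectangular bands, with $\mathbf{N}_k$, the finite $k$-nilpotent semigroups.) $\mathbf{V}$ has bounded diameter if there is a constant $D \geq 1$ such that for every $S \in \mathbf{V}$ and every generating set $\Sigma \subseteq S$, every element of $S$ is a product of generators from $\Sigma$ of length at most $D$. Straight-line programs. Let $S$ be a finite semigroup and $\Sigma \subseteq S$. A straight-line program over $\Sigma$ is a finite sequence of instructions executed in order and operating on registers $r_1, r_2, \dots$, each able to store one element of $S$. Each instruction is either $r_k \gets s$ for some $s \in \Sigma$, or $r_k \gets r_i \cdot r_j$, where $i,j,k$ need not be distinct and $r_i, r_j$ must have been assigned by previous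 instructions. Its length is the number of its instructions, its width is the number of registers it operates on. It computes $t \in S$ if upon completion some register contains $t$. For $2 \leq w \leq \infty$, $c^w_S(t;\Sigma)$ denotes the minimal length of a straight-line program over $\Sigma$ of width at most $w$ computing $t$. Put $C^w_S = \max\{c^w_S(t;\Sigma) : \Sigma \subseteq S,\ t \in \langle \Sigma \rangle\}$, where $\langle\Sigma\rangle$ is the subsemigroup generated by $\Sigma$, and $C^w_{\mathbf{V}}(N) = \max\{C^w_S : S \in \mathbf{V}, |S| \leq N\}$. Asymptotics are for $N \to \infty$. *)

(* Defs.v *)
From HB Require Import structures.
From mathcomp Require Import all_boot all_order all_algebra.
From mathcomp Require Import all_classical all_reals all_analysis.

Set Implicit Arguments.
Unset Strict Implicit.
Unset Printing Implicit Defensive.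

Import Order.TTheory GRing.Theory Num.Theory.
Import numFieldNormedType.Exports.

#[short(type="finSemigroupType")]
HB.structure Definition FinSemigroup := {S of Semigroup S & Finite S}.

Section DirectProduct.
Variables (I : finType) (S : I -> finSemigroupType).
Implicit Types f g h : {dffun forall i, S i}.

Definition dffun_mulg f g : {dffun forall i, S i} :=
  [ffun i => (f i * g i)%g].

Lemma dffun_mulgA : associative dffun_mulg.
Proof. by move=> f g h; apply/ffunP => i; rewrite !ffunE mulgA. Qed.

HB.instance Definition _ :=
  isSemigroup.Build {dffun forall i, S i} dffun_mulgA.

End DirectProduct.

Section FiniteSemigroup.
Variable S : finSemigroupType.
Implicit Types (Sigma A : {set S}) (s : seq S) (t : S) (k : nat).

(* The empty sequence has no product. *)
Definition sprod s : option S :=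
  if s is x :: s' then Some (foldl *%g x s') else None.

Definition subsemigroup A : bool := [forall x in A, forall y in A, (x * y)%g \in A].

Definition generated Sigma : {set S} :=
  (\bigcap_(A : {set S} | subsemigroup A && (Sigma \subset A)) A)%SET.

Definition generating Sigma : Prop := generated Sigma = [set: S]%SET.

Definition ideal_power k : {set S} :=
  [set t | [exists s : k.-tuple S, sprod s == Some t]]%SET.

Definition rectangular_band A : Prop :=
  (forall x, x \in A -> (x * x)%g = x) /\
  (forall x y z, x \in A -> y \in A -> z \in A -> (x * y * z)%g = (x * z)%g).

End FiniteSemigroup.

(* Put k s is  r_k <- s  and  Mul k i j  is  r_k <- r_i * r_j. *)
Variant instruction (S : Type) :=
  | Put of nat & S
  | Mul of nat & nat & nat.

Arguments Mul {S}.

Section StraightLinePrograms.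
Variable S : finSemigroupType.

Definition memory := nat -> option S.

Definition store (m : memory) (k : nat) (x : S) : memory :=
  fun l => if l == k then Some x else m l.

Definition step (Sigma : {set S}) (m : memory) (i : instruction S) : option memory :=
  match i with
  | Put k s => if s \in Sigma then Some (store m k s) else None
  | Mul k i j =>
      if (m i, m j) is (Some x, Some y) then Some (store m k (x * y)%g) else None
  end.

(* None when an instruction is illegal: it loads an element outside of Sigma
   or reads a register that has not been assigned. *)
Fixpoint run (Sigma : {set S}) (m : memory) (p : seq (instruction S)) : option memory :=
  if p is i :: p' then
    if step Sigma m i is Some m' then run Sigma m' p' else None
  else Some m.

Definition registers (p : seq (instruction S)) : seq nat :=
  flatten [seq match i with
               | Put k _ => [:: k]
               | Mul k i j => [:: k; i; j]
               end | i <- p].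

Definition width (p : seq (instruction S)) : nat := size (undup (registers p)).

(* The bound None stands for infinity. *)
Definition width_at_most (w : option nat) (p : seq (instruction S)) : Prop :=
  if w is Some b then (width p <= b)%N else True.

Definition computes (Sigma : {set S}) (p : seq (instruction S)) (t : S) : Prop :=
  exists m k, run Sigma (fun=> None) p = Some m /\ m k = Some t.

End StraightLinePrograms.

Local Open Scope classical_set_scope.

(* Both default to 0 if the minimum (resp. maximum) does not exist. *)
Definition min_nat (A : set nat) : nat := xget 0%N (A `&` lbound A).
Definition max_nat (A : set nat) : nat := xget 0%N (A `&` ubound A).

Lemma min_natP (A : set nat) :
  A !=set0 -> A (min_nat A) /\ forall n, A n -> (min_nat A <= n)%N.
Proof.
move=> [n An]; have exA : exists n, `[< A n >] by exists n; apply/asboolP.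
have [m /asboolP Am lem] := ex_minnP exA.
suff [] : (A `&` lbound A) (min_nat A) by [].
by apply: (xgetI _ (x := m)); split=> // k Ak; apply: lem; apply/asboolP.
Qed.

Lemma max_natP (A : set nat) b :
  A !=set0 -> (forall n, A n -> (n <= b)%N) ->
  A (max_nat A) /\ forall n, A n -> (n <= max_nat A)%N.
Proof.
move=> [n An] leb; have exA : exists n, `[< A n >] by exists n; apply/asboolP.
have leA k : `[< A k >] -> (k <= b)%N by move/asboolP/leb.
have [m /asboolP Am gem] := ex_maxnP exA leA.
suff [] : (A `&` ubound A) (max_nat A) by [].
by apply: (xgetI _ (x := m)); split=> // k Ak; apply: gem; apply/asboolP.
Qed.

(* The set is nonempty if 2 <= w and t is in generated Sigma. *)
Definition slp_cost (S : finSemigroupType) (w : option nat) (Sigma : {set S}) (t : S) : nat :=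
  min_nat [set n | exists p : seq (instruction S),
             [/\ computes Sigma p t, width_at_most w p & size p = n]].

Definition slp_cost_semigroup (w : option nat) (S : finSemigroupType) : nat :=
  \max_(Sigma : {set S}) \max_(t in generated Sigma) slp_cost w Sigma t.

(* Every element of generated Sigma is a product of at most #|S| generators, so
   for 2 <= w the set is bounded by 2 * N. *)
Definition slp_cost_class (V : finSemigroupType -> Prop) (w : option nat) (N : nat) : nat :=
  max_nat [set n | exists S : finSemigroupType,
             [/\ V S, (#|S| <= N)%N & slp_cost_semigroup w S = n]].

(* The product of the empty family is the one-element semigroup. Since #|S| = 0
   is not excluded by finSemigroupType, subsemigroups are required to be
   nonempty; whether V contains the empty semigroup is immaterial. *)
Record pseudovariety (V : finSemigroupType -> Prop) : Prop := Pseudovariety {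
  pseudovariety_prod : forall (n : nat) (S : 'I_n -> finSemigroupType),
    (forall i, V (S i)) -> V {dffun forall i, S i};
  pseudovariety_sub : forall (S T : finSemigroupType) (f : {multiplicative S -> T}),
    (0 < #|S|)%N -> injective f -> V T -> V S;
  pseudovariety_img : forall (S T : finSemigroupType) (f : {multiplicative S -> T}),
    (forall y, exists x, f x = y) -> V S -> V T
}.

Definition bounded_diameter (V : finSemigroupType -> Prop) : Prop :=
  exists2 D : nat, (1 <= D)%N &
    forall (S : finSemigroupType) (Sigma : {set S}), V S -> generating Sigma ->
      forall t : S, exists s : seq S,
        [/\ {subset s <= Sigma}, (size s <= D)%N & sprod s = Some t].

(* The Mal'cev product of the finite rectangular bands with the finite
   k-nilpotent semigroups. *)
Definition RB_N (k : nat) (S : finSemigroupType) : Prop :=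
  rectangular_band (ideal_power S k).

Definition constant_cost (R : realType) (V : finSemigroupType -> Prop) (w : option nat) : Prop :=
  (fun N => (slp_cost_class V w N)%:R%R : R) =O_\oo (fun=> 1%R : R).

Definition logarithmic_cost (R : realType) (V : finSemigroupType -> Prop) (w : option nat) : Prop :=
  (fun N => (slp_cost_class V w N)%:R%R : R) =Omega_\oo (fun N => ln (N%:R%R : R)).

(* Main.v *)
From HB Require Import structures.
Require Import Defs.
From mathcomp Require Import all_boot all_order all_algebra.
From mathcomp Require Import all_classical all_reals all_analysis.
From mathcomp Require Import zify.

Set Implicit Arguments.
Unset Strict Implicit.
Unset Printing Implicit Defensive.

Import Order.TTheory GRing.Theory Num.Theory.
Import numFieldNormedType.Exports.

(** If [S^k] is a rectangular band for every [S] in [V], then a product of more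
    than [3 k] generators factors as [u m v] with [u], [m], [v] in [S^k], hence
    equals [u v], of length [2 k]: the diameter is at most [3 k], and a word of
    length [D] is evaluated with two registers in [2 D] instructions.

    Otherwise a constant [c] is found such that, for all [n], some [T] in [V]
    with at most [c ^ n] elements needs programs of length [n]; this gives the
    logarithmic lower bound, and excludes a bounded diameter.  In each [T] a
    product of [n] generators escapes, for each generator, a subsemigroup
    containing all the others, so that a program must load them all
    ([slp_cost_semigroup_ge]).

    If some local monoid [e S e] is nontrivial, [T] is the power [S^n]: the
    generators have one component different from [e]
    ([nontrivial_local_monoid_cost]).

    If all local monoids are trivial, the idempotents form an ideal, which is a
    rectangular band containing all long products.  As for each [k] some
    [S^k] is not a rectangular band, there are for every [k] products of [k]
    elements that are not idempotent, and even such that no longer product has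
    the same value ([unextendable_word]).  Replacing letters by an
    idempotent in further coordinates of a direct power then separates
    [x_1 ... x_n] from all words that are not permutations of it
    ([content_of_unextendable]).  Two cases remain.

    If [V] satisfies no nontrivial permutation identity, adding coordinates that
    refute each of these identities separates [x_1 ... x_n] from all other
    words.  The semigroup of its factors, with a zero, is thus a quotient: its
    elements are intervals, and their number is quadratic in [n]
    ([permutation_free_cost]).

    If [V] satisfies a permutation identity, then, as observed by Putcha and
    Yaqub, letters far from both ends of a word commute
    ([jumps_of_permutation_identity], [commutes_inside_of_jumps]).  The factors
    of the middle part of a long word are thus determined by their sets of
    letters, and there are at most [2 ^ n] of them ([commutes_inside_cost]). *)

(** * Products of words *)

Section OptionalProduct.
Variable S : finSemigroupType.
Implicit Types (x y t : S) (s : seq S) (a b : option S).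

(** The monoid obtained from [S] by adjoining an identity [None], in which
    [sprod] is a morphism from words. *)
Definition omul a b : option S :=
  match a, b with
  | Some x, Some y => Some (x * y)%g
  | None, _ => b
  | _, None => a
  end.

Lemma omulA : associative omul.
Proof. by case=> [x|] [y|] [z|] //=; rewrite mulgA. Qed.

Lemma sprod_cons x s : sprod (x :: s) = omul (Some x) (sprod s).
Proof.
elim: s x => [|y s IHs] x //.
have -> : sprod [:: x, y & s] = sprod ((x * y)%g :: s) by [].
by rewrite !IHs; case: (sprod s) => [t|] //=; rewrite mulgA.
Qed.

Lemma sprod_cat s1 s2 : sprod (s1 ++ s2) = omul (sprod s1) (sprod s2).
Proof. by elim: s1 => [//|x s1 IHs]; rewrite cat_cons !sprod_cons IHs omulA. Qed.

Lemma sprod_someP s : reflect (exists t, sprod s = Some t) (s != [::]).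
Proof.
apply: (iffP idP) => [|[t]]; last by case: s.
by case: s => [//|x s] _; rewrite sprod_cons; case: (sprod s) => [t|]; eexists.
Qed.

Lemma sprod_mem (A : {set S}) s t :
  subsemigroup A -> {subset s <= A} -> sprod s = Some t -> t \in A.
Proof.
move=> /forall_inP Amul; elim: s t => [//|x s IHs] t sA.
have Ax : x \in A by apply: sA; rewrite mem_head.
have {}sA : {subset s <= A} by move=> y ys; apply: sA; rewrite in_cons ys orbT.
rewrite sprod_cons; case s_val: (sprod s) => [y|] [<-] //.
by move/forall_inP: (Amul x Ax); apply; apply: IHs.
Qed.

(** The pigeonhole principle for the values of the nonempty prefixes. *)
Lemma prefix_collision s :
  (#|S| < size s)%N ->
  exists s1 s2 s3 (t : S), [/\ s = s1 ++ s2 ++ s3, s1 != [::], s2 != [::],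
    sprod s1 = Some t & sprod (s1 ++ s2) = Some t].
Proof.
case: s => [//|x0 s0]; set s := x0 :: s0 => long.
pose f (i : 'I_(size s)) := odflt x0 (sprod (take i.+1 s)).
have fE (i : 'I_(size s)) : sprod (take i.+1 s) = Some (f i).
  by have /sprod_someP[t val] : take i.+1 s != [::] by []; rewrite /f val.
have /injectivePn[i [j neq_ij f_ij]] : ~~ injectiveb f.
  by apply: contraL long => /injectiveP/leq_card; rewrite card_ord -leqNgt.
wlog lt_ij : i j neq_ij f_ij / (i < j)%N.
  move=> wl; case: (ltngtP i j) => [lt_ij|lt_ji|/val_inj eq_ij]; first exact: (wl i j).
    by apply: (wl j i) => //; rewrite eq_sym.
  by rewrite eq_ij eqxx in neq_ij.
exists (take i.+1 s), (drop i.+1 (take j.+1 s)), (drop j.+1 s), (f i).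
have cut : take i.+1 s ++ drop i.+1 (take j.+1 s) = take j.+1 s.
  by rewrite -{1}(@take_takel _ i.+1 j.+1 s) ?cat_take_drop // ltnS ltnW.
split=> //; last by rewrite cut fE f_ij.
  by rewrite catA cut cat_take_drop.
by rewrite -size_eq0 size_drop size_takel ?ltn_ord // subSS subn_eq0 -ltnNge.
Qed.

End OptionalProduct.

Lemma sprod_map (S T : finSemigroupType) (f : {multiplicative S -> T}) s :
  sprod (map f s) = omap f (sprod s).
Proof.
elim: s => [//|x s IHs]; rewrite [map _ _]/= !sprod_cons IHs.
by case: (sprod s) => [t|] //=; rewrite gmulfM.
Qed.

(** Colliding prefixes [x^i] and [x^(i+d)] make the powers of [x] periodic from
    [i] on, with period [d]; the exponent [i d] is at least [i] and a multiple
    of [d]. *)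
Lemma idempotent_power (S : finSemigroupType) (x : S) :
  exists n e, sprod (nseq n x) = Some e /\ (e * e)%g = e.
Proof.
have [|s1 [s2 [s3 [t [s_cat s1_n0 s2_n0 p1 p2]]]]] :=
  @prefix_collision S (nseq #|S|.+1 x); first by rewrite size_nseq.
have xs y : y \in s1 ++ s2 -> y = x.
  move=> y_s; have : y \in nseq #|S|.+1 x by rewrite s_cat catA mem_cat y_s.
  by rewrite mem_nseq => /andP[_ /eqP].
have powers s : {subset s <= s1 ++ s2} -> s = nseq (size s) x.
  by move=> s_sub; apply/all_pred1P/allP => y /s_sub/xs->; rewrite /= eqxx.
have {}powers1 := powers s1 (fun y => @mem_subseq _ _ _ (prefix_subseq s1 s2) y).
have {}powers2 := powers s2 (fun y => @mem_subseq _ _ _ (suffix_subseq s1 s2) y).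
set i := size s1 in powers1; set d := size s2 in powers2.
have d_gt0 : (0 < d)%N by rewrite lt0n size_eq0.
have shift k l : sprod (nseq (i + k + l * d) x) = sprod (nseq (i + k) x).
  elim: l => [|l IHl]; first by rewrite addn0.
  have -> : (i + k + l.+1 * d = i + d + (k + l * d))%N by rewrite mulSn; lia.
  rewrite !nseqD -powers1 -powers2 sprod_cat p2 -p1 powers1 -sprod_cat -!nseqD.
  by rewrite addnA IHl.
have k_ge : (i + (i * d - i) = i * d)%N.
  by rewrite subnKC // leq_pmulr.
have := shift (i * d - i)%N i; rewrite k_ge => dbl.
have /sprod_someP[e e_val] : nseq (i * d) x != [::].
  by rewrite -size_eq0 size_nseq muln_eq0 negb_or -!lt0n d_gt0 lt0n size_eq0 s1_n0.
exists (i * d)%N, e; split=> //.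
by move: dbl; rewrite nseqD sprod_cat e_val => -[].
Qed.

(** * Subsemigroups *)

(** The closure proof is a parameter so that the semigroup structure can be
    inferred from the type. *)
Definition subsemigroup_type (S : finSemigroupType) (A : {set S})
  (A_mul : subsemigroup A) := {x : S | x \in A}.

Section SubsemigroupType.
Variables (S : finSemigroupType) (A : {set S}) (A_mul : subsemigroup A).
Local Notation T := (subsemigroup_type A_mul).

HB.instance Definition _ := Finite.copy T {x : S | x \in A}.
HB.instance Definition _ := SubType.copy T {x : S | x \in A}.

Definition subsemigroup_mul (x y : T) : T :=
  exist _ (sval x * sval y)%g
    (forall_inP (forall_inP A_mul _ (svalP x)) _ (svalP y)).

Lemma subsemigroup_mulA : associative subsemigroup_mul.
Proof. by move=> x y z; apply: val_inj; rewrite /= mulgA. Qed.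

HB.instance Definition _ := isSemigroup.Build T subsemigroup_mulA.

Definition subsemigroup_val : T -> S := sval.

Lemma subsemigroup_valM : {morph subsemigroup_val : x y / (x * y)%g}.
Proof. by []. Qed.

HB.instance Definition _ := isMultiplicative.Build T S subsemigroup_val subsemigroup_valM.

Lemma card_subsemigroup : #|{: T}| = #|A|.
Proof. by rewrite card_sig; apply: eq_card. Qed.
End SubsemigroupType.

Lemma pseudovariety_subsemigroup (V : finSemigroupType -> Prop) (S : finSemigroupType)
    (A : {set S}) (A_mul : subsemigroup A) :
  pseudovariety V -> V S -> (0 < #|A|)%N -> V (subsemigroup_type A_mul).
Proof.
move=> Vp VS A_gt0.
apply: (pseudovariety_sub Vp (f := @subsemigroup_val S A A_mul)) => //.
  by rewrite card_subsemigroup.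
exact: val_inj.
Qed.

Section Generated.
Variable S : finSemigroupType.
Implicit Types (Sigma : {set S}) (t : S) (s : seq S).

Lemma generatedP Sigma t :
  reflect (exists2 s, {subset s <= Sigma} & sprod s = Some t) (t \in generated Sigma).
Proof.
apply: (iffP idP) => [t_gen|[s s_sub s_val]]; last first.
  apply/bigcapP => A /andP[A_mul /fintype.subsetP A_sub].
  by apply: sprod_mem s_val => // x /s_sub/A_sub.
pose A := [set t | `[< exists2 s, {subset s <= Sigma} & sprod s = Some t >]]%SET.
suff : t \in A by rewrite inE => /asboolP.
move/bigcapP: t_gen; apply; apply/andP; split.
  apply/forall_inP => x; rewrite inE => /asboolP[s1 sub1 val1].
  apply/forall_inP => y; rewrite inE => /asboolP[s2 sub2 val2].
  rewrite inE; apply/asboolP; exists (s1 ++ s2); last by rewrite sprod_cat val1 val2.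
  by move=> z; rewrite mem_cat => /orP[/sub1|/sub2].
apply/fintype.subsetP => x Sx; rewrite inE; apply/asboolP; exists [:: x] => //.
by move=> y; rewrite inE => /eqP->.
Qed.

Lemma subsemigroup_generated Sigma : subsemigroup (generated Sigma).
Proof.
apply/forall_inP => x /generatedP[s1 sub1 val1]; apply/forall_inP => y /generatedP[s2 sub2 val2].
apply/generatedP; exists (s1 ++ s2); last by rewrite sprod_cat val1 val2.
by move=> z; rewrite mem_cat => /orP[/sub1|/sub2].
Qed.

(** Cutting out the factor between two prefixes of equal value shortens a word. *)
Lemma generated_short_word Sigma t :
  t \in generated Sigma ->
  exists s, [/\ {subset s <= Sigma}, (size s <= #|S|)%N & sprod s = Some t].
Proof.
case/generatedP=> s; have [m] := ubnP (size s); elim: m s => // m IHm s /ltnSE s_le s_sub s_val.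
have [?|/prefix_collision[s1 [s2 [s3 [a [s_cat _ s2_n0 p1 p2]]]]]] := leqP (size s) #|S|.
  by exists s.
apply: (IHm (s1 ++ s3)).
- apply: leq_trans s_le; rewrite s_cat !size_cat ltn_add2l -[X in (X < _)%N]add0n ltn_add2r.
  by rewrite lt0n size_eq0.
- move=> x; rewrite mem_cat => x_s; apply: s_sub; rewrite s_cat !mem_cat orbCA.
  by rewrite x_s orbT.
- by rewrite -s_val s_cat catA !(sprod_cat _ s3) p1 p2.
Qed.
End Generated.

(** * Straight-line programs *)

Section Programs.
Variable S : finSemigroupType.
Implicit Types (Sigma A : {set S}) (t : S) (s : seq S) (p : seq (instruction S)).

Definition word_program s : seq (instruction S) :=
  if s is x :: s' then Put 0 x :: flatten [seq [:: Put 1 y; Mul 0 0 1] | y <- s']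
  else [::].

Lemma size_word_program s : (size (word_program s) <= 2 * size s)%N.
Proof.
case: s => // x s /=; suff -> : size (flatten [seq [:: Put 1 y; Mul 0 0 1] | y <- s]) = (2 * size s)%N by lia.
by elim: s => //= y s ->; lia.
Qed.

Lemma width_word_program s : (width (word_program s) <= 2)%N.
Proof.
apply: (@uniq_leq_size _ _ [:: 0; 1]%N (undup_uniq _)) => k; rewrite mem_undup.
case: s => // x s; rewrite /registers /= in_cons => /orP[/eqP->//|].
by elim: s => //= y s IHs; rewrite !in_cons => /or4P[/eqP->|/eqP->|/eqP->|/orP[/eqP->|/IHs]].
Qed.

Lemma word_program_computes Sigma s t :
  {subset s <= Sigma} -> sprod s = Some t -> computes Sigma (word_program s) t.
Proof.
case: s => // x s s_sub [<-] {t}; rewrite /computes /= s_sub ?mem_head //.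
have {s_sub} : {subset s <= Sigma} by move=> y y_s; apply: s_sub; rewrite in_cons y_s orbT.
have : store (fun=> None) 0 x 0 = Some x by [].
move: (store _ 0 x) => m; elim: s m x => [|y s IHs] m x m0 s_sub; first by exists m, 0.
rewrite /= s_sub ?mem_head //= /store /= m0; apply: IHs => // z z_s.
by apply: s_sub; rewrite in_cons z_s orbT.
Qed.

Lemma slp_cost_word (w : option nat) Sigma s t :
  (if w is Some b then 2 <= b else true)%N ->
  {subset s <= Sigma} -> sprod s = Some t ->
  exists2 p, [/\ computes Sigma p t, width_at_most w p & size p = slp_cost w Sigma t]
           & (slp_cost w Sigma t <= 2 * size s)%N.
Proof.
move=> w_ge2 s_sub s_val.
pose costs : set nat := [set n | exists p : seq (instruction S),
  [/\ computes Sigma p t, width_at_most w p & size p = n]]%classic.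
have costs_word : costs (size (word_program s)).
  exists (word_program s); split=> //; first exact: word_program_computes.
  by move: w_ge2; rewrite /width_at_most; case: (w) => // b; apply: leq_trans (width_word_program s).
have [[p p_min] le_costs] := min_natP (ex_intro _ _ costs_word).
exists p => //; exact: leq_trans (le_costs _ costs_word) (size_word_program s).
Qed.

Lemma slp_cost_semigroup_le (w : option nat) d :
  (if w is Some b then 2 <= b else true)%N ->
  (forall Sigma t, t \in generated Sigma ->
     exists s, [/\ {subset s <= Sigma}, (size s <= d)%N & sprod s = Some t]) ->
  (slp_cost_semigroup w S <= 2 * d)%N.
Proof.
move=> w_ge2 short; apply/bigmax_leqP => Sigma _; apply/bigmax_leqP => t /short[s [s_sub s_le s_val]].
have [_ _ cost_le] := slp_cost_word w_ge2 s_sub s_val.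
by apply: leq_trans cost_le _; rewrite leq_mul2l.
Qed.

Definition loads p : seq S := pmap (fun i => if i is Put _ x then Some x else None) p.

Lemma size_loads p : (size (loads p) <= size p)%N.
Proof. by rewrite size_pmap count_size. Qed.

Lemma run_subsemigroup Sigma A p (m m' : memory S) :
  subsemigroup A -> (forall x, x \in Sigma -> x \in loads p -> x \in A) ->
  (forall k x, m k = Some x -> x \in A) -> run Sigma m p = Some m' ->
  forall k x, m' k = Some x -> x \in A.
Proof.
move=> A_mul; elim: p m => [|i p IHp] m load_A mA /=; first by case=> <-.
case step_i: (step Sigma m i) => [m1|//]; apply: IHp.
  move=> x Sx x_p; apply: load_A => //; case: (i) => [k y|k j l] //=.
  by rewrite in_cons x_p orbT.
case: i step_i load_A => [k y|k j l] /=.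
  case: ifP => // Sy [<-] load_A l x; rewrite /store; case: eqP => _; last exact: mA.
  by case=> <-; apply: load_A; rewrite ?mem_head.
case mj: (m j) => [y|//]; case ml: (m l) => [z|//] [<-] _ l' x; rewrite /store.
case: eqP => _; last exact: mA.
by case=> <-; move/forall_inP: (forall_inP A_mul y (mA _ _ mj)); apply; apply: mA ml.
Qed.

(** As long as the generator [z i] has not been loaded, all registers contain
    elements of [A i], which excludes [t].  So a program computing [t] loads
    the [n] generators, and these are distinct because [z i] is the only one
    outside of [A i]. *)
Lemma slp_cost_semigroup_ge n (z : 'I_n -> S) (A : 'I_n -> {set S}) t :
  sprod (map z (enum 'I_n)) = Some t ->
  (forall i, subsemigroup (A i)) -> (forall i j, j != i -> z j \in A i) ->
  (forall i, t \notin A i) ->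
  (n <= slp_cost_semigroup None S)%N.
Proof.
move=> t_val A_mul zA tA; pose Sigma := [set z i | i : 'I_n]%SET.
have z_sub : {subset map z (enum 'I_n) <= Sigma}.
  by move=> x /mapP[i _ ->]; apply: imset_f.
have z_notin i : z i \notin A i.
  apply: contra (tA i) => zi; apply: sprod_mem t_val => // x /mapP[j _ ->].
  by have [->|/zA] := eqVneq j i.
have z_inj : injective z.
  by move=> i j eq_z; apply/eqP/negPn/negP => /zA; rewrite eq_z (negPf (z_notin j)).
have t_gen : t \in generated Sigma by apply/generatedP; exists (map z (enum 'I_n)).
have [p [[m [k [run_p mk]]] _ p_size] _] := @slp_cost_word None _ _ _ isT z_sub t_val.
apply: leq_trans (leq_bigmax Sigma); apply: leq_trans (leq_bigmax_cond _ t_gen).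
rewrite -p_size; apply: leq_trans (size_loads p).
have loaded i : z i \in loads p.
  apply: contraNT (tA i) => zi_n; apply: run_subsemigroup run_p _ _ mk => // x.
  move=> /imsetP[j _ ->] zj; apply: zA; apply: contraNneq zi_n => <- //.
have -> : n = size (map z (enum 'I_n)) by rewrite size_map size_enum_ord.
apply: uniq_leq_size; first by rewrite map_inj_uniq ?enum_uniq.
by move=> x /mapP[i _ ->].
Qed.

End Programs.

Section CostOfClass.
Variable V : finSemigroupType -> Prop.

Lemma slp_cost_class_le (w : option nat) b N :
  (forall S : finSemigroupType, V S -> (slp_cost_semigroup w S <= b)%N) ->
  (slp_cost_class V w N <= b)%N.
Proof.
move=> cost_le; rewrite /slp_cost_class /max_nat.
case: xgetP => [n _ [[S [VS _ <-]] _]|_] //; exact: cost_le.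
Qed.

Lemma slp_cost_class_ge (S : finSemigroupType) N :
  V S -> (#|S| <= N)%N -> (slp_cost_semigroup None S <= slp_cost_class V None N)%N.
Proof.
move=> VS S_le.
pose costs : set nat := [set n | exists S : finSemigroupType,
  [/\ V S, (#|S| <= N)%N & slp_cost_semigroup None S = n]]%classic.
have costs_S : costs (slp_cost_semigroup None S) by exists S.
have [|_] := @max_natP costs (2 * N) (ex_intro _ _ costs_S); last exact.
move=> n [T [_ T_le <-]]; apply: slp_cost_semigroup_le => // Sigma t.
move=> /generated_short_word[s [s_sub s_le s_val]].
by exists s; split=> //; apply: leq_trans T_le.
Qed.

End CostOfClass.

(** * Asymptotics *)

Section Asymptotics.
Variables (R : realType) (V : finSemigroupType -> Prop).

Lemma constant_cost_bounded (w : option nat) b :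
  (forall N, slp_cost_class V w N <= b)%N -> constant_cost R V w.
Proof.
move=> cost_le; apply/eqO_exP; exists (b.+1%:R)%R; first by rewrite ltr0n.
apply: nearW => N; rewrite normr1 mulr1 ger0_norm ?ler0n // ler_nat.
exact: leq_trans (cost_le N) _.
Qed.

Lemma not_logarithmic_cost_bounded b :
  (forall N, slp_cost_class V None N <= b)%N -> ~ logarithmic_cost R V None.
Proof.
move=> cost_le; rewrite /logarithmic_cost eqOmegaE qualifE => /asboolP[k k_gt0 [N0 _ ge_log]].
pose N := maxn N0 (Num.truncn (expR (b%:R / k + 1 : R))).+1.
have N_gt : (expR (b%:R / k + 1) < N%:R :> R)%R.
  apply: lt_le_trans (_ : (Num.truncn (expR (b%:R / k + 1 : R))).+1%:R <= _)%R.
    by rewrite truncnS_gt.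
  by rewrite ler_nat leq_maxr.
have N_gt0 : (0 < N%:R :> R)%R by apply: lt_trans N_gt; rewrite expR_gt0.
have ln_gt : (b%:R / k + 1 < ln N%:R :> R)%R by rewrite -ltr_expR lnK ?posrE.
have := ge_log N (leq_maxl _ _); rewrite /= [`|_%:R|%R]ger0_norm ?ler0n // => k_le.
have : (k * ln N%:R <= b%:R :> R)%R.
  apply: le_trans (le_trans _ k_le) _; last by rewrite ler_nat.
  by rewrite ler_pM2l ?ler_norm.
apply/negP; rewrite -ltNge -ltr_pdivrMl // mulrC; apply: lt_trans ln_gt.
by rewrite ltrDl.
Qed.

(** For given [N] the largest [n] with [c ^ n <= N] is of order [ln N]. *)
Lemma logarithmic_cost_exponential c :
  (1 < c)%N ->
  (forall n, (0 < n)%N -> exists S : finSemigroupType,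
     [/\ V S, (#|S| <= c ^ n)%N & (n <= slp_cost_semigroup None S)%N]) ->
  logarithmic_cost R V None.
Proof.
move=> c_gt1 family; rewrite /logarithmic_cost eqOmegaE qualifE; apply/asboolP.
have ln_c : (0 < ln (c%:R : R))%R by rewrite ln_gt0 // ltr1n.
exists (2 * ln (c%:R : R))^-1%R; first by rewrite invr_gt0 mulr_gt0.
exists c => // N /= c_le; set n := trunc_log c N.
have N_gt0 : (0 < N)%N by apply: leq_trans c_le; apply: ltnW.
have n_gt0 : (0 < n)%N by rewrite trunc_log_gt0 c_gt1; lia.
have [S [VS S_le cost_ge]] := family n n_gt0.
have {}cost_ge : (n <= slp_cost_class V None N)%N.
  apply: leq_trans cost_ge _; apply: slp_cost_class_ge => //.
  by apply: leq_trans S_le _; rewrite trunc_logP.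
have ln_ge0 : (0 <= ln (N%:R : R))%R by rewrite ln_ge0 // ler1n.
rewrite /= !ger0_norm ?ler0n // ler_pdivrMl ?mulr_gt0 //.
have ln_N : (ln (N%:R : R) <= ln (c%:R : R) *+ n.+1)%R.
  by rewrite -lnXn ?ltr0n 1?ltnW // ler_ln ?posrE ?exprn_gt0 ?ltr0n // -?natrX ?ler_nat 1?ltnW // trunc_log_ltn.
apply: le_trans ln_N _; rewrite -[(_ *+ n.+1)%R]mulr_natr (mulrC 2%R) -mulrA ler_pM2l //.
by rewrite -natrM ler_nat; apply: leq_trans (leq_mul (leqnn 2) cost_ge); lia.
Qed.

End Asymptotics.

(** * Members of a pseudovariety presented by relations *)

Section Projection.
Variables (I : finType) (S : I -> finSemigroupType) (i : I).

Definition dffun_proj (f : {dffun forall i, S i}) : S i := f i.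

Lemma dffun_projM : {morph dffun_proj : f g / (f * g)%g}.
Proof. by move=> f g; rewrite /dffun_proj ffunE. Qed.

HB.instance Definition _ := isMultiplicative.Build _ _ dffun_proj dffun_projM.
End Projection.

Lemma generated_imageP n (S : finSemigroupType) (x : 'I_n -> S) t :
  reflect (exists u, sprod (map x u) = Some t) (t \in generated [set x i | i : 'I_n]%SET).
Proof.
apply: (iffP (generatedP _ _)) => [[s s_sub s_val]|[u u_val]]; last first.
  by exists (map x u) => // y /mapP[i _ ->]; apply: imset_f.
suff [u s_u] : exists u, s = map x u by exists u; rewrite -s_u.
elim: s s_sub {s_val} => [|y s IHs] s_sub; first by exists [::].
have /imsetP[i _ ->] := s_sub y (mem_head _ _).
have [|u ->] := IHs; first by move=> w w_s; apply: s_sub; rewrite in_cons w_s orbT.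
by exists (i :: u).
Qed.

Section Presentations.
Variables (V : finSemigroupType -> Prop) (V_pv : pseudovariety V) (n : nat).

(** The members of the family are the components of the letters in a direct
    product. *)
Lemma pseudovariety_family (I : finType) (S : I -> finSemigroupType)
    (y : forall a, 'I_n -> S a) :
  (forall a, V (S a)) ->
  exists2 T : finSemigroupType, V T & exists x : 'I_n -> T, forall u v,
    sprod (map x u) = sprod (map x v) ->
    forall a, sprod (map (y a) u) = sprod (map (y a) v).
Proof.
move=> VS; pose S' (k : 'I_#|I|) := S (enum_val k).
exists {dffun forall k, S' k}; first by apply: (pseudovariety_prod V_pv) => k; apply: VS.
exists (fun i => [ffun k => y (enum_val k) i]) => u v eq_uv a.
rewrite -(enum_rankK a); move: (enum_rank a) => k.
have proj w : sprod (map (y (enum_val k)) w) = omap (@dffun_proj _ S' k)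
    (sprod (map (fun i => [ffun k => y (enum_val k) i] : {dffun forall k, S' k}) w)).
  rewrite -(sprod_map (@dffun_proj _ S' k)) -map_comp; congr sprod.
  by apply: eq_map => i /=; rewrite /dffun_proj ffunE.
by rewrite !proj eq_uv.
Qed.

(** Sending the value of a word at [x] to its value at [z] is a well-defined
    morphism between the generated subsemigroups. *)
Lemma pseudovariety_relations (T M : finSemigroupType) (x : 'I_n -> T) (z : 'I_n -> M) :
  V T -> (0 < n)%N ->
  (forall u v, sprod (map x u) = sprod (map x v) -> sprod (map z u) = sprod (map z v)) ->
  V (subsemigroup_type (subsemigroup_generated [set z i | i : 'I_n]%SET)).
Proof.
move=> VT n_gt0 rel_xz.
set G := subsemigroup_type (subsemigroup_generated [set x i | i : 'I_n]%SET).
set H := subsemigroup_type _.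
have VG : V G.
  apply: pseudovariety_subsemigroup => //; apply/card_gt0P; exists (x (Ordinal n_gt0)).
  by apply/generated_imageP; exists [:: Ordinal n_gt0].
have value_ex (g : G) : exists h : H, exists u,
    sprod (map x u) = Some (sval g) /\ sprod (map z u) = Some (sval h).
  have /generated_imageP[u u_val] := svalP g.
  have /sprod_someP[t t_val] : map z u != [::] by case: u u_val.
  by exists (exist _ t (introT (generated_imageP _ _) (ex_intro _ u t_val))), u.
have [f fP] := choice value_ex.
have f_eq g u : sprod (map x u) = Some (sval g) -> sprod (map z u) = Some (sval (f g)).
  by have [v [<- <-]] := fP g; apply: rel_xz.
have fM : {morph f : g h / (g * h)%g}.
  move=> g h; apply: val_inj; apply: Some_inj.
  have [u [xu zu]] := fP g; have [v [xv zv]] := fP h.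
  by rewrite -(f_eq _ (u ++ v)) map_cat sprod_cat ?xu ?xv ?zu ?zv.
pose f' : {multiplicative G -> H} := HB.pack f (isMultiplicative.Build G H f fM).
apply: (pseudovariety_img V_pv (f := f')) VG => h.
have /generated_imageP[u zu] := svalP h.
have /sprod_someP[t xu] : map x u != [::] by case: u zu.
exists (exist _ t (introT (generated_imageP _ _) (ex_intro _ u xu))).
apply: val_inj; apply: Some_inj; rewrite -zu; apply/esym.
exact: (f_eq (exist _ t _)).
Qed.

(** The semigroup generated by [z] belongs to [V] although [M] need not, which
    allows [M] to be a concrete semigroup larger than necessary. *)
Lemma pseudovariety_relations_cost (I : finType) (S : I -> finSemigroupType)
    (y : forall a, 'I_n -> S a) (M : finSemigroupType) (z : 'I_n -> M)
    (A : 'I_n -> {set M}) (t : M) :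
  (forall a, V (S a)) -> (0 < n)%N ->
  (forall u v, (forall a, sprod (map (y a) u) = sprod (map (y a) v)) ->
     sprod (map z u) = sprod (map z v)) ->
  sprod (map z (enum 'I_n)) = Some t ->
  (forall i, subsemigroup (A i)) -> (forall i j, j != i -> z j \in A i) ->
  (forall i, t \notin A i) ->
  exists T : finSemigroupType,
    [/\ V T, (#|T| <= #|M|)%N & (n <= slp_cost_semigroup None T)%N].
Proof.
move=> VS n_gt0 rel_yz z_val A_mul zA tA.
have [T VT [x rel_xy]] := pseudovariety_family y VS.
have rel_xz u v : sprod (map x u) = sprod (map x v) -> sprod (map z u) = sprod (map z v).
  by move=> /rel_xy/rel_yz.
set gen_mul := subsemigroup_generated [set z i | i : 'I_n]%SET.
exists (subsemigroup_type gen_mul); split.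
- exact: pseudovariety_relations rel_xz.
- by rewrite card_subsemigroup max_card.
have z_gen i : z i \in generated [set z i | i : 'I_n]%SET.
  by apply/generated_imageP; exists [:: i].
have t_gen : t \in generated [set z i | i : 'I_n]%SET.
  by apply/generated_imageP; exists (enum 'I_n).
pose z' i : subsemigroup_type gen_mul := exist _ (z i) (z_gen i).
pose val' := @subsemigroup_val _ _ gen_mul.
apply: (@slp_cost_semigroup_ge _ n z' (fun i => [set w | val' w \in A i]%SET)
  (exist _ t t_gen)).
- have := z_val; rewrite -(eq_map (f := val' \o z')) // map_comp sprod_map.
  by case: (sprod _) => // w [w_t]; congr Some; apply: val_inj.
- move=> i; apply/forall_inP => v; rewrite inE => vA; apply/forall_inP => w; rewrite !inE => wA.
  by move/forall_inP: (forall_inP (A_mul i) _ vA); apply.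
- by move=> i j /zA; rewrite inE.
- by move=> i; rewrite inE; apply: tA.
Qed.

End Presentations.

(** * Bounded diameter *)

Section IdealPower.
Variable S : finSemigroupType.
Implicit Types (s : seq S) (t : S).

Lemma ideal_powerP k t :
  reflect (exists2 s, size s = k & sprod s = Some t) (t \in ideal_power S k).
Proof.
rewrite inE; apply: (iffP existsP) => [[s /eqP s_val]|[s s_size s_val]].
  by exists s; rewrite ?size_tuple.
by move/eqP: s_size => s_size; exists (Tuple s_size); apply/eqP.
Qed.

Lemma ideal_power_ge k s t :
  (0 < k <= size s)%N -> sprod s = Some t -> t \in ideal_power S k.
Proof.
case/andP=> k_gt0 k_le; rewrite -(cat_take_drop k.-1 s) sprod_cat.
have : drop k.-1 s != [::] by rewrite -size_eq0 size_drop -lt0n subn_gt0 prednK.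
case/sprod_someP=> x x_val; rewrite x_val => t_val.
apply/ideal_powerP; exists (take k.-1 s ++ [:: x]); last by rewrite sprod_cat.
by rewrite size_cat size_takel /=; lia.
Qed.

(** In a long product the part between the first and the last [k] letters
    can be dropped. *)
Lemma rectangular_band_generated_short k (Sigma : {set S}) t :
  (0 < k)%N -> RB_N k S -> t \in generated Sigma ->
  exists s, [/\ {subset s <= Sigma}, (size s <= 3 * k)%N & sprod s = Some t].
Proof.
move=> k_gt0 [_ rect] /generatedP[s s_sub s_val].
have [?|long] := leqP (size s) (3 * k); first by exists s.
pose u := take k s; pose m := take (size s - 2 * k) (drop k s).
pose v := drop (size s - 2 * k) (drop k s).
have s_cat : s = u ++ m ++ v by rewrite !cat_take_drop.
have u_size : size u = k by rewrite size_takel //; lia.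
have v_size : size v = k by rewrite !size_drop; lia.
have m_size : (k <= size m)%N by rewrite size_takel ?size_drop; lia.
have ideal w : (k <= size w)%N -> exists2 x, sprod w = Some x & x \in ideal_power S k.
  move=> w_ge; have /sprod_someP[x x_val] : w != [::] by rewrite -size_eq0 -lt0n (leq_trans k_gt0).
  by exists x => //; apply: ideal_power_ge x_val; rewrite k_gt0.
have [|x x_val xI] := ideal u; first by rewrite u_size.
have [y y_val yI] := ideal m m_size.
have [|z z_val zI] := ideal v; first by rewrite v_size.
exists (u ++ v); split.
- by move=> w w_uv; apply: s_sub; rewrite s_cat !mem_cat orbCA -mem_cat w_uv orbT.
- by rewrite size_cat u_size v_size; lia.
- rewrite -s_val s_cat !sprod_cat x_val y_val z_val /=.
  by rewrite mulgA rect.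
Qed.
End IdealPower.

Section BoundedDiameter.
Variable V : finSemigroupType -> Prop.

Lemma bounded_diameter_RB_N k :
  (0 < k)%N -> (forall S, V S -> RB_N k S) -> bounded_diameter V.
Proof.
move=> k_gt0 VRB; exists (3 * k)%N => [|S Sigma VS Sigma_gen t]; first by rewrite muln_gt0.
by apply: rectangular_band_generated_short (VRB S VS) _; rewrite ?Sigma_gen ?inE.
Qed.

(** The diameter bound, which is about generating sets, applies to the
    subsemigroup generated by [Sigma]. *)
Lemma bounded_diameter_generated :
  pseudovariety V -> bounded_diameter V ->
  exists D, forall (S : finSemigroupType) (Sigma : {set S}) t, V S -> t \in generated Sigma ->
    exists s, [/\ {subset s <= Sigma}, (size s <= D)%N & sprod s = Some t].
Proof.
move=> V_pv [D _ diam]; exists D => S Sigma t VS t_gen.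
pose T := subsemigroup_type (subsemigroup_generated Sigma).
have VT : V T by apply: pseudovariety_subsemigroup => //; apply/card_gt0P; exists t.
pose val' : {multiplicative T -> S} := @subsemigroup_val _ _ (subsemigroup_generated Sigma).
have T_gen : @generating T [set x | val' x \in Sigma]%SET.
  apply/setP => x; rewrite inE; have /generatedP[s s_sub s_val] := svalP x.
  have [u s_u] : exists u, s = map val' u.
    elim: s s_sub {s_val} => [|y s IHs] s_sub; first by exists [::].
    have Sy : y \in Sigma by apply: s_sub; rewrite mem_head.
    have y_gen : y \in generated Sigma.
      by apply/generatedP; exists [:: y] => // w; rewrite inE => /eqP->.
    have [|u ->] := IHs; first by move=> w w_s; apply: s_sub; rewrite in_cons w_s orbT.
    by exists ((exist _ y y_gen : T) :: u).
  apply/generatedP; exists u.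
    by move=> w w_u; rewrite inE; apply: s_sub; rewrite s_u map_f.
  move: s_val; rewrite s_u sprod_map; case: (sprod u) => // w [w_x].
  by congr Some; apply: val_inj.
have [u [u_sub u_le u_val]] := diam T _ VT T_gen (exist _ t t_gen).
exists (map val' u); split; last by rewrite sprod_map u_val.
  by move=> y /mapP[x /u_sub x_S ->]; rewrite inE in x_S.
by rewrite size_map.
Qed.

Lemma bounded_diameter_cost :
  pseudovariety V -> bounded_diameter V ->
  exists b, forall (w : option nat), (if w is Some b then 2 <= b else true)%N ->
    forall N, (slp_cost_class V w N <= b)%N.
Proof.
move=> V_pv /(bounded_diameter_generated V_pv)[D short]; exists (2 * D)%N => w w_ge2 N.
by apply: slp_cost_class_le => S VS; apply: slp_cost_semigroup_le => // Sigma t; apply: short.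
Qed.
End BoundedDiameter.

(** * Local monoids *)

(** In the power [S^n] let the [j]-th generator have the component [e s e] at [j]
    and [e] elsewhere.  Since [e] acts as an identity on [e s e], the product of
    all generators is constantly [e s e], and a product lacking the [i]-th one
    has [i]-th component [e]. *)
Lemma nontrivial_local_monoid_cost (V : finSemigroupType -> Prop) (S : finSemigroupType)
    (e s : S) n :
  pseudovariety V -> V S -> (e * e)%g = e -> (e * s * e)%g <> e -> (0 < n)%N ->
  exists T : finSemigroupType,
    [/\ V T, (#|T| <= #|S| ^ n)%N & (n <= slp_cost_semigroup None T)%N].
Proof.
move=> V_pv VS ee; set g := (e * s * e)%g => /eqP g_neq n_gt0.
have eg : (e * g)%g = g by rewrite /g !mulgA ee.
have ge : (g * e)%g = g by rewrite /g -mulgA ee.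
pose T : finSemigroupType := {dffun forall i : 'I_n, (fun=> S) i}.
exists T; split; first exact: (pseudovariety_prod V_pv).
  by rewrite card_dep_ffun foldrE big_map big_enum prod_nat_const card_ord.
pose z (j : 'I_n) : T := [ffun i => if i == j then g else e].
pose proj i : {multiplicative T -> S} := @dffun_proj _ (fun=> S) i.
have z_val i u : uniq u -> u != [::] -> omap (proj i) (sprod (map z u)) =
    Some (if i \in u then g else e).
  rewrite -sprod_map -map_comp; elim: u => // j u IHu; rewrite cons_uniq => /andP[j_u u_uniq] _.
  rewrite map_cons sprod_cons in_cons [X in omul (Some X)]/= /dffun_proj ffunE; have [-> //|u_n0] := eqVneq u [::].
    by rewrite in_nil orbF; case: eqP.
  rewrite IHu //; have [->|_] := eqVneq i j; first by rewrite (negPf j_u) /= ge.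
  by rewrite /=; case: ifP; rewrite ?eg ?ee.
have enum_n0 : enum 'I_n != [::] by rewrite -size_eq0 size_enum_ord -lt0n.
apply: (@slp_cost_semigroup_ge _ n z (fun i => [set f | proj i f == e]%SET)
  ([ffun=> g] : T)).
- have /sprod_someP[t t_val] : map z (enum 'I_n) != [::] by case: (enum _) enum_n0.
  rewrite t_val; congr Some; apply/ffunP => i; rewrite ffunE.
  by have := z_val i _ (enum_uniq _) enum_n0; rewrite t_val mem_enum => -[].
- move=> i; apply/forall_inP => f; rewrite inE => /eqP fi; apply/forall_inP => h.
  by rewrite !inE => /eqP hi; rewrite gmulfM fi hi ee.
- by move=> i j ji; rewrite inE /= /dffun_proj ffunE [i == j]eq_sym (negPf ji).
- by move=> i; rewrite inE /= /dffun_proj ffunE.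
Qed.

(** * Locally trivial semigroups *)

(** The local monoids [e S e] are trivial. *)
Definition locally_trivial (S : finSemigroupType) : Prop :=
  forall e s : S, (e * e)%g = e -> (e * s * e)%g = e.

Section LocallyTrivial.
Variables (S : finSemigroupType) (lt : locally_trivial S).
Implicit Types (s u v : seq S) (e t : S).

Lemma omul_locally_trivial e (c : option S) :
  (e * e)%g = e -> omul (omul (Some e) c) (Some e) = Some e.
Proof. by move=> ee; case: c => [s|] /=; rewrite ?lt ?ee. Qed.

Lemma idempotent_word e s t :
  (e * e)%g = e -> e \in s -> sprod s = Some t -> (t * t)%g = t.
Proof.
move=> ee; case/splitPr=> s1 s2; rewrite sprod_cat sprod_cons.
set a := sprod s1; set b := sprod s2 => t_val; apply: Some_inj.
have -> : Some (t * t)%g = omul (Some t) (Some t) by [].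
rewrite -t_val -!omulA; congr (omul _ _).
by rewrite [omul b _]omulA [omul _ (omul (Some e) b)]omulA [omul _ (omul _ b)]omulA omulA omul_locally_trivial.
Qed.

(** Two prefixes of equal value differ by a word acting trivially, so that
    all its powers, an idempotent among them, can be inserted. *)
Lemma long_word_idempotent s t :
  (#|S| < size s)%N -> sprod s = Some t -> (t * t)%g = t.
Proof.
move=> /prefix_collision[s1 [s2 [s3 [a [s_cat _ /sprod_someP[b b_val] p1]]]]].
rewrite sprod_cat p1 b_val => ab t_val.
have [n [e [e_val ee]]] := idempotent_power b.
apply: (@idempotent_word e (a :: e :: s3)) => //; first by rewrite !inE eqxx orbT.
rewrite -t_val s_cat !sprod_cat !sprod_cons omulA p1 b_val [in RHS]omulA ab -e_val; congr omul.
by elim: n {e_val} => [|n IHn] //; rewrite [nseq _ _]/= sprod_cons omulA ab.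
Qed.

(** Both [x z] and [x y z] arise from [x y z x z], as [x = x (y z) x] and
    [z = z x z]. *)
Lemma idempotent_rectangular_band (A : {set S}) :
  (forall x, x \in A -> (x * x)%g = x) -> rectangular_band A.
Proof.
move=> A_idem; split=> // x y z /A_idem xx _ /A_idem zz.
have <- : (x * (y * z) * x * z)%g = (x * z)%g by rewrite lt.
by rewrite -!mulgA [(z * (x * z))%g]mulgA lt.
Qed.
End LocallyTrivial.

(** In a fixed semigroup, words whose value is not idempotent have bounded length.  The prefix of
    length [k] of a longest one has the required property, since a longer word
    of the same value could replace it. *)
Lemma unextendable_word (V : finSemigroupType -> Prop) :
  (forall S : finSemigroupType, V S -> locally_trivial S) ->
  ~ (exists2 k, (1 <= k)%N & forall S : finSemigroupType, V S -> RB_N k S) ->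
  forall k, (0 < k)%N -> exists2 S : finSemigroupType, V S & exists2 s : seq S,
    size s = k & forall s', sprod s' = sprod s -> (size s' <= k)%N.
Proof.
move=> V_lt V_RB k k_gt0; have [S VS not_RB] : exists2 S : finSemigroupType, V S & ~ RB_N k S.
  apply: contrapT => no_S; apply: V_RB; exists k => // S VS.
  by apply: contrapT => not_RB; apply: no_S; exists S.
have lt := V_lt S VS; exists S => //.
pose wild n := `[< exists2 s : seq S, size s = n &
                   exists2 t, sprod s = Some t & (t * t)%g <> t >].
have wild_k : wild k.
  apply/asboolP; apply: contrapT => no_s; apply: not_RB.
  apply: idempotent_rectangular_band lt _ _ => t /ideal_powerP[s s_size s_val].
  by apply: contrapT => tt; apply: no_s; exists s => //; exists t.
have wild_le n : wild n -> (n <= #|S|)%N.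
  move=> /asboolP[s <- [t s_val tt]]; rewrite leqNgt; apply/negP => long.
  exact: tt (long_word_idempotent lt long s_val).
have [n /asboolP[s s_size [t s_val tt]] max_n] := ex_maxnP (ex_intro _ k wild_k) wild_le.
have k_le : (k <= size s)%N by rewrite s_size max_n.
exists (take k s) => [|s' s'_val]; first by rewrite size_takel.
have : wild (size (s' ++ drop k s)).
  apply/asboolP; exists (s' ++ drop k s) => //; exists t => //.
  by rewrite sprod_cat s'_val -sprod_cat cat_take_drop.
by move=> /max_n; rewrite size_cat size_drop; lia.
Qed.

(** Replacing the letter [j] by an idempotent makes the whole product idempotent,
    and an idempotent is a product of arbitrarily many elements.  So a word [v]
    lacking [j], which is not affected by the replacement, is told apart from the
    word [enum 'I_n] by the coordinates [None] and [Some j].  The coordinate [None]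
    also excludes words [v] of length more than [n]. *)
Lemma content_of_unextendable (S : finSemigroupType) n (x : 'I_n -> S) (P Q : seq S)
    (e : S) (v : seq 'I_n) :
  locally_trivial S -> (e * e)%g = e ->
  (forall s', sprod s' = sprod (P ++ map x (enum 'I_n) ++ Q) ->
     (size s' <= size (P ++ map x (enum 'I_n) ++ Q))%N) ->
  (forall o : option 'I_n,
     let x' i := if o == Some i then e else x i in
     sprod (P ++ map x' v ++ Q) = sprod (P ++ map x' (enum 'I_n) ++ Q)) ->
  perm_eq v (enum 'I_n).
Proof.
move=> lt ee; set w := P ++ _ => unext eq_v.
have v_size : (size v <= n)%N.
  by have := unext _ (eq_v None); rewrite /w !size_cat 2!size_map size_enum_ord leq_add2l leq_add2r.
have v_all j : j \in v.
  apply/negPn/negP => j_v; have := eq_v (Some j); rewrite /=.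
  have -> : map (fun i => if Some j == Some i then e else x i) v = map x v.
    by apply/eq_in_map => i i_v; case: eqP => // -[ij]; rewrite ij i_v in j_v.
  rewrite (eq_v None : sprod (P ++ map x v ++ Q) = sprod w).
  set w' := P ++ _ => eq_w.
  have e_w' : e \in w'.
    rewrite !mem_cat; apply/orP; right; apply/orP; left; apply/mapP; exists j.
      by rewrite mem_enum.
    by rewrite eqxx.
  have /sprod_someP[t t_val] : w' != [::] by case: (w') e_w'.
  have tt : (t * t)%g = t by apply: idempotent_word ee e_w' t_val.
  suff /unext : sprod (nseq (size w).+1 t) = sprod w by rewrite size_nseq ltnn.
  rewrite eq_w t_val.
  by elim: (size w) => // m IHm; rewrite [nseq _ _]/= sprod_cons IHm /= tt.
apply: uniq_perm; rewrite ?enum_uniq //.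
  by apply: (@leq_size_uniq _ (enum 'I_n)); rewrite ?enum_uniq ?size_enum_ord.
by move=> i; rewrite v_all mem_enum.
Qed.

(** * Permutation identities *)

Section PermutationIdentity.
Variable V : finSemigroupType -> Prop.

(** The length of [v] is exact: it is by combining two different lengths
    that [y] is moved by a single letter. *)
Definition jumps (a d b : nat) : Prop :=
  forall T : finSemigroupType, V T -> forall (p v q : seq T) y,
  (a <= size p)%N -> size v = d -> (b <= size q)%N ->
  sprod (p ++ y :: v ++ q) = sprod (p ++ v ++ y :: q).

Definition commutes_inside (r : nat) : Prop :=
  forall T : finSemigroupType, V T -> forall (p q : seq T) x y,
  (r <= size p)%N -> (r <= size q)%N ->
  sprod (p ++ x :: y :: q) = sprod (p ++ y :: x :: q).

(** Otherwise the positions in [u] of the letters of [s] would be consecutive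
    integers, which have to start from 0. *)
Lemma perm_broken_adjacency (A : eqType) (x0 : A) (s u : seq A) :
  uniq s -> perm_eq u s -> u <> s ->
  exists2 i, (i.+1 < size s)%N & index (nth x0 s i.+1) u <> (index (nth x0 s i) u).+1.
Proof.
move=> s_uniq us u_s; apply: contrapT => adj; apply: u_s.
have size_us := perm_size us.
have u_mem i : (i < size s)%N -> nth x0 s i \in u.
  by move=> i_lt; rewrite (perm_mem us) mem_nth.
have indexD i : (i < size s)%N -> index (nth x0 s i) u = (index (nth x0 s 0) u + i)%N.
  elim: i => [|i IHi] i_lt; first by rewrite addn0.
  rewrite addnS -IHi; last exact: ltnW.
  by apply: contrapT => ne; apply: adj; exists i.
have [s0|s_gt0] := posnP (size s).
  by rewrite (size0nil s0); apply: size0nil; rewrite size_us.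
have index0 : index (nth x0 s 0) u = 0%N.
  have last_lt : ((size s).-1 < size s)%N by rewrite prednK.
  have := u_mem _ last_lt; rewrite -index_mem indexD // size_us -[X in (_ < X)%N]prednK //.
  by rewrite ltnS -[X in (_ <= X)%N]add0n leq_add2r leqn0 => /eqP.
apply: (@eq_from_nth _ x0) => // i; rewrite size_us => i_lt.
by rewrite -[i in LHS]add0n -index0 -indexD // nth_index ?u_mem.
Qed.

(** Moving [y] from the cut [al] to the cut [be] is a jump over the letters in
    between; longer words are handled by adding a prefix and a suffix. *)
Lemma jumps_of_cuts n al be :
  al != be -> (al <= n)%N -> (be <= n)%N ->
  (forall (T : finSemigroupType) (g : seq T) y, V T -> size g = n ->
     sprod (take al g ++ y :: drop al g) = sprod (take be g ++ y :: drop be g)) ->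
  exists a d b, (0 < d)%N /\ jumps a d b.
Proof.
wlog lt_ab : al be / (al < be)%N.
  move=> wl neq_ab al_le be_le cuts; case: (ltngtP al be) => [lt|lt|eq_ab].
  - exact: (wl al be).
  - by apply: (wl be al) => //; [rewrite eq_sym | move=> T g y VT /cuts->].
  - by rewrite eq_ab eqxx in neq_ab.
move=> _ _ be_le cuts; exists al, (be - al)%N, (n - be)%N; split; first by rewrite subn_gt0.
move=> T VT p v q y p_ge v_size q_ge.
pose p0 := take (size p - al) p; pose p1 := drop (size p - al) p.
pose q1 := take (n - be) q; pose q0 := drop (n - be) q.
have p_cat : p = p0 ++ p1 by rewrite cat_take_drop.
have q_cat : q = q1 ++ q0 by rewrite cat_take_drop.
have p1_size : size p1 = al by rewrite size_drop subKn.
have q1_size : size q1 = (n - be)%N by rewrite size_takel.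
have pv_size : size (p1 ++ v) = be by rewrite size_cat p1_size v_size subnKC // ltnW.
have := cuts T (p1 ++ v ++ q1) y VT; rewrite catA size_cat pv_size q1_size subnKC // => /(_ erefl).
rewrite [take be _]take_size_cat // [drop be _]drop_size_cat // -catA take_size_cat // drop_size_cat // => jump.
have -> : p ++ y :: v ++ q = p0 ++ (p1 ++ y :: v ++ q1) ++ q0.
  by rewrite p_cat q_cat -!catA cat_cons -catA.
have -> : p ++ v ++ y :: q = p0 ++ ((p1 ++ v) ++ y :: q1) ++ q0.
  by rewrite p_cat q_cat -!catA cat_cons.
by rewrite !(sprod_cat p0) !(sprod_cat _ q0) jump.
Qed.

(** Let [c] and [c'] be consecutive in [enum 'I_n] but not in [u].  Multiplying
    [c] by [y] on the right or [c'] by [y] on the left makes no difference in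
    [enum 'I_n], but inserts [y] at two different places of [u].  The identity
    turns this into a jump. *)
Lemma jumps_of_permutation_identity n (u : seq 'I_n) :
  perm_eq u (enum 'I_n) -> u <> enum 'I_n ->
  (forall T : finSemigroupType, V T -> forall x : 'I_n -> T,
     sprod (map x u) = sprod (map x (enum 'I_n))) ->
  exists a d b, (0 < d)%N /\ jumps a d b.
Proof.
move=> u_perm u_neq u_id.
have x0 : 'I_n by case: (u) (enum 'I_n) u_perm u_neq => [|x ?] [|y ?] //=.
have [i i_lt i_adj] := perm_broken_adjacency x0 (enum_uniq _) u_perm u_neq.
set c := nth x0 _ i in i_adj; set c' := nth x0 _ i.+1 in i_adj.
have u_uniq : uniq u by rewrite (perm_uniq u_perm) enum_uniq.
have u_size : size u = n by rewrite (perm_size u_perm) size_enum_ord.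
have u_mem j : j \in u by rewrite (perm_mem u_perm) mem_enum.
have cc' : c != c'.
  by have -> := nth_uniq x0 (ltnW i_lt) i_lt (enum_uniq _); rewrite neq_ltn ltnSn.
have enum_cat : enum 'I_n = take i (enum 'I_n) ++ [:: c; c'] ++ drop i.+2 (enum 'I_n).
  by rewrite /= -[X in c :: X]drop_nth // -drop_nth ?cat_take_drop // ltnW.
have insert (T : finSemigroupType) (g : 'I_n -> T) y : V T ->
    sprod (map g (take (index c u) u) ++ g c :: y :: map g (drop (index c u).+1 u)) =
    sprod (map g (take (index c' u) u) ++ y :: g c' :: map g (drop (index c' u).+1 u)).
  move=> VT.
  pose g1 j := if j == c then (g c * y)%g else g j.
  pose g2 j := if j == c' then (y * g c')%g else g j.
  have g1E w : c \notin w -> map g1 w = map g w.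
    by move=> cw; apply/eq_in_map => j jw; rewrite /g1; case: eqP => // jc; rewrite -jc jw in cw.
  have g2E w : c' \notin w -> map g2 w = map g w.
    by move=> cw; apply/eq_in_map => j jw; rewrite /g2; case: eqP => // jc; rewrite -jc jw in cw.
  have split_u j : u = take (index j u) u ++ j :: drop (index j u).+1 u.
    by rewrite -{2}(nth_index x0 (u_mem j)) -drop_nth ?index_mem // cat_take_drop.
  have notin j : j \notin take (index j u) u /\ j \notin drop (index j u).+1 u.
    move: u_uniq; rewrite {1}(split_u j) cat_uniq /= negb_or => /and3P[_ /andP[-> _] /andP[-> _]].
    by [].
  have -> : sprod (map g (take (index c u) u) ++ g c :: y :: map g (drop (index c u).+1 u)) =
            sprod (map g1 u).
    have [n1 n2] := notin c.
    rewrite [in RHS](split_u c) map_cat map_cons !g1E // !sprod_cat !sprod_cons /g1 eqxx.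
    by rewrite (omulA (Some (g c))).
  have -> : sprod (map g (take (index c' u) u) ++ y :: g c' :: map g (drop (index c' u).+1 u)) =
            sprod (map g2 u).
    have [n1 n2] := notin c'.
    rewrite [in RHS](split_u c') map_cat map_cons !g2E // !sprod_cat !sprod_cons /g2 eqxx.
    by rewrite (omulA (Some y)).
  rewrite !u_id // enum_cat.
  have := enum_uniq 'I_n; rewrite {1}enum_cat cat_uniq [has _ _]/= [uniq (_ ++ _)]/= !inE !negb_or.
  rewrite -!andbA => /and5P[_ c_t c'_t _ /and4P[_ c_d c'_d _]].
  rewrite !map_cat (g1E _ c_t) (g1E _ c_d) (g2E _ c'_t) (g2E _ c'_d) !sprod_cat; congr (omul _ (omul _ _)).
  by rewrite !map_cons /g1 /g2 /= !eqxx (negPf cc') [c' == c]eq_sym (negPf cc') !mulgA.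
have cuts (T : finSemigroupType) (g : seq T) y : V T -> size g = n ->
    sprod (take (index c u).+1 g ++ y :: drop (index c u).+1 g) =
    sprod (take (index c' u) g ++ y :: drop (index c' u) g).
  move=> VT g_size; pose x j := nth y g (index j u).
  have index_lt j : (index j u < size g)%N by have := u_mem j; rewrite -index_mem u_size g_size.
  have g_x : map x u = g.
    apply: (@eq_from_nth _ y) => [|k]; rewrite size_map u_size // => k_lt.
    by rewrite (nth_map x0) ?u_size // /x index_uniq ?u_size.
  have := insert T x y VT; rewrite !map_take !map_drop g_x => ins.
  by rewrite (take_nth y) // cat_rcons ins (drop_nth y (index_lt c')).
apply: (jumps_of_cuts (al := (index c u).+1) (be := index c' u) _ _ _ cuts).
- by apply/eqP => eq_i; apply: i_adj.
- by have := u_mem c; rewrite -index_mem u_size.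
- by have := u_mem c'; rewrite -index_mem u_size => /ltnW.
Qed.

(** A jump of [y] over the [d.+1] letters of [x v], followed by a jump back over
    the [d] letters of [v], exchanges [y] and [x]. *)
Lemma commutes_inside_of_jumps a d b :
  (0 < d)%N -> jumps a d b -> exists r, commutes_inside r.
Proof.
move=> d_gt0 jump.
(* The first two letters of a longer block are merged into one. *)
have jumpS : jumps a d.+1 b.
  move=> T VT p [//|v0 [|v1 v]] q y p_ge [v_size] q_ge; first by rewrite -v_size in d_gt0.
  have := jump T VT p ((v0 * v1)%g :: v) q y p_ge v_size q_ge.
  by rewrite !cat_cons !sprod_cat !sprod_cons -!/(omul (Some v0) (Some v1)) -!omulA.
exists (maxn a (d + b)) => T VT p q x y; rewrite !geq_max => /andP[p_ge _] /andP[_ q_ge].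
have d_le : (d <= size q)%N by apply: leq_trans q_ge; apply: leq_addr.
have v_size : size (take d q) = d by rewrite size_takel.
have q'_ge : (b <= size (drop d q))%N by rewrite size_drop leq_subRL.
have px_ge : (a <= size (p ++ [:: x]))%N by rewrite size_cat (leq_trans p_ge) // leq_addr.
have step1 := jumpS T VT p (x :: take d q) (drop d q) y p_ge (congr1 S v_size) q'_ge.
have step2 := jump T VT (p ++ [:: x]) (take d q) (drop d q) y px_ge v_size q'_ge.
rewrite !cat_cons cat_take_drop in step1.
rewrite -!catA cat_take_drop !cat1s in step2.
by rewrite step1 step2.
Qed.

Lemma commutes_inside_perm r (T : finSemigroupType) (A : eqType) (x : A -> T)
    (P Q : seq T) (u v : seq A) :
  commutes_inside r -> V T -> (r <= size P)%N -> (r <= size Q)%N -> perm_eq u v ->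
  sprod (P ++ map x u ++ Q) = sprod (P ++ map x v ++ Q).
Proof.
move=> comm VT P_ge Q_ge; elim: u v P P_ge => [|c u IHu] v P P_ge uv.
  by have := perm_size uv; case: v uv.
have : c \in v by rewrite -(perm_mem uv) mem_head.
move=> c_v; case/splitPr: c_v uv => v1 v2 uv.
have front P' : (r <= size P')%N ->
    sprod (P' ++ x c :: map x (v1 ++ v2) ++ Q) = sprod (P' ++ map x (v1 ++ c :: v2) ++ Q).
  elim: v1 P' {uv} => [//|d v1 IHv] P' P'_ge.
  rewrite cat_cons map_cons cat_cons comm // ?size_cat; last by rewrite (leq_trans Q_ge) // leq_addl.
  by rewrite -cat_rcons IHv ?size_rcons ?leqW // cat_rcons.
rewrite -front // map_cons cat_cons -!cat_rcons; apply: IHu; first by rewrite size_rcons leqW.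
by rewrite -(perm_cons c) (perm_trans uv) // perm_catC /= perm_cons perm_catC.
Qed.

End PermutationIdentity.

(** * Intervals and disjoint unions *)

(** The Brandt semigroup, [None] being its zero.  A pair [(a, b)] with [a < b]
    stands for the factor [x_a ... x_(b-1)] of [x_0 ... x_(n-1)]. *)
Definition interval_semigroup (n : nat) : Type := option ('I_n.+1 * 'I_n.+1).

Section IntervalSemigroup.
Variable n : nat.
Local Notation T := (interval_semigroup n).

HB.instance Definition _ := Finite.copy T (option ('I_n.+1 * 'I_n.+1)).

Definition interval_mul (x y : T) : T :=
  if (x, y) is (Some (a, b), Some (c, d)) then
    if b == c then Some (a, d) else None
  else None.

Lemma interval_mulA : associative interval_mul.
Proof.
case=> [[a b]|] [[c d]|] [[e f]|] //; rewrite /interval_mul; last by case: ifP.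
by case de: (d == e); case bc: (b == c); rewrite /= ?de ?bc.
Qed.

HB.instance Definition _ := isSemigroup.Build T interval_mulA.

Lemma interval_mulE (x y : T) : (x * y)%g = interval_mul x y.
Proof. by []. Qed.

Definition unit_interval (i : 'I_n) : T := Some (inord i, inord i.+1).

Lemma card_interval_semigroup : #|{: T}| = (n.+1 ^ 2).+1.
Proof. by rewrite card_option card_prod card_ord. Qed.

Lemma unit_intervals_word u (a b : 'I_n.+1) :
  sprod (map unit_interval u) = Some (Some (a, b)) ->
  (a < b)%N /\ map val u = iota a (b - a).
Proof.
elim: u a => [//|i u IHu] a; rewrite map_cons sprod_cons.
have i_val : (inord i : 'I_n.+1) = i :> nat by rewrite inordK // ltnW // ltnS.
have i1_val : (inord i.+1 : 'I_n.+1) = i.+1 :> nat by rewrite inordK // ltnS.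
have [->|u_n0] := eqVneq u [::].
  by case=> <- <-; rewrite i_val i1_val subSnn.
case u_val: (sprod _) => [[[c d]|]|] //; last by case: (u) u_n0 u_val.
move=> /Some_inj; rewrite interval_mulE /interval_mul /unit_interval; case: eqP => // i1_c [<- d_b]; rewrite d_b in u_val.
have := IHu c u_val; rewrite -i1_c i_val i1_val map_cons => -[u_lt ->].
by split; [exact: ltnW | rewrite -(subnSK (ltnW u_lt))].
Qed.

Lemma unit_intervals_iota u a k (ak : (a + k <= n)%N) :
  (0 < k)%N -> map val u = iota a k ->
  sprod (map unit_interval u) = Some (Some (inord a, inord (a + k))).
Proof.
elim: k a u ak => // k IHk a [//|i u] ak _ [i_a u_iota]; rewrite map_cons sprod_cons.
have [k0|k_gt0] := posnP k.
  by move: u_iota; rewrite k0 addn1 /unit_interval i_a; case: u.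
rewrite (IHk i.+1 u) ?i_a ?addSnnS // [omul _ _]/= interval_mulE /unit_interval.
by rewrite /interval_mul i_a eqxx.
Qed.

End IntervalSemigroup.

(** A set stands for the product of its letters in any order, and the zero [None]
    for all words with a repeated letter. *)
Definition disjoint_union_semigroup (n : nat) : Type := option {set 'I_n}.

Section DisjointUnionSemigroup.
Variable n : nat.
Local Notation T := (disjoint_union_semigroup n).

HB.instance Definition _ := Finite.copy T (option {set 'I_n}).

Definition disjoint_union (x y : T) : T :=
  if (x, y) is (Some A, Some B) then
    if (A :&: B == finset.set0)%SET then Some (A :|: B)%SET else None
  else None.

Lemma disjoint_unionA : associative disjoint_union.
Proof.
case=> [A|] [B|] [C|] //; rewrite /disjoint_union; last by case: ifP.
case AB: (A :&: B == finset.set0)%SET; case BC: (B :&: C == finset.set0)%SET => //.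
- by rewrite finset.setIUr finset.setIUl !finset.setU_eq0 AB BC andbT finset.setUA.
- by rewrite finset.setIUl finset.setU_eq0 BC andbF.
- by rewrite finset.setIUr finset.setU_eq0 AB.
Qed.

HB.instance Definition _ := isSemigroup.Build T disjoint_unionA.

Lemma disjoint_unionE (x y : T) : (x * y)%g = disjoint_union x y.
Proof. by []. Qed.

Definition singleton (i : 'I_n) : T := Some [set i]%SET.

Lemma card_disjoint_union_semigroup : #|{: T}| = (2 ^ n).+1.
Proof. by rewrite card_option -cardsT -powersetT card_powerset cardsT card_ord. Qed.

Lemma singletons_word u :
  u != [::] -> sprod (map singleton u) =
  Some (if uniq u then Some [set i in u]%SET else None).
Proof.
elim: u => // i u IHu _; rewrite map_cons sprod_cons.
have [->|u_n0] := eqVneq u [::].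
  by congr (Some (Some _)); apply/setP => j; rewrite !inE.
rewrite IHu // cons_uniq; case: (uniq u); last by rewrite andbF.
rewrite andbT; congr Some; rewrite disjoint_unionE /disjoint_union /singleton.
have -> : ([set i] :&: [set j in u] == finset.set0)%SET = (i \notin u).
  by rewrite setI_eq0 disjoints1 inE.
case: ifP => // _; congr Some; apply/setP => j.
by rewrite !inE.
Qed.

End DisjointUnionSemigroup.

(** * Logarithmic lower bound *)

(** By symmetry, only nonzero values need to be recovered.  The index [a0] makes
    the family nonempty, so that it separates the empty word, the only one
    without a value, from the other words. *)
Lemma relations_of_nonzero n (I : finType) (S : I -> finSemigroupType)
    (y : forall a, 'I_n -> S a) (M : finSemigroupType) (z : 'I_n -> M) (zero : M) (a0 : I) :
  let rel u v := forall a, sprod (map (y a) u) = sprod (map (y a) v) in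
  (forall u v, rel u v -> forall m, sprod (map z u) = Some m -> m <> zero ->
     sprod (map z v) = Some m) ->
  forall u v, rel u v -> sprod (map z u) = sprod (map z v).
Proof.
move=> rel nonzero u v rel_uv; have rel_vu : rel v u by move=> a; rewrite rel_uv.
have empty_uv : (u == [::]) = (v == [::]).
  have none w : (w == [::]) = (sprod (map (y a0) w) == None) by case: w.
  by rewrite !none rel_uv.
case zu: (sprod (map z u)) => [m|]; last by case: (u) (v) zu empty_uv => [|? ?] [].
have [m0|m_n0] := pselect (m = zero); last by rewrite (nonzero u v rel_uv m).
case zv: (sprod (map z v)) => [m'|]; last by case: (v) (u) zv zu empty_uv => [|? ?] [].
have [m'0|m'_n0] := pselect (m' = zero); first by rewrite m0 m'0.
by rewrite -zu (nonzero v u rel_vu m').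
Qed.

Section LowerBound.
Variables (V : finSemigroupType -> Prop) (V_pv : pseudovariety V).
Hypothesis V_lt : forall S : finSemigroupType, V S -> locally_trivial S.
Hypothesis V_unext : forall k, (0 < k)%N ->
  exists2 S : finSemigroupType, V S & exists2 s : seq S,
    size s = k & forall s', sprod s' = sprod s -> (size s' <= k)%N.

(** An unextendable word of length [r + n + r] provides the letters and their
    surroundings [P] and [Q], in which letters may commute while those of [P] and
    [Q] stay in place. *)
Lemma content_family r n : (0 < n)%N ->
  exists2 S : finSemigroupType, V S & exists (x : option 'I_n -> 'I_n -> S) (P Q : seq S),
    [/\ size P = r, size Q = r &
      forall v : seq 'I_n,
        (forall o, sprod (P ++ map (x o) v ++ Q) = sprod (P ++ map (x o) (enum 'I_n) ++ Q)) ->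
        perm_eq v (enum 'I_n)].
Proof.
move=> n_gt0; have [|S VS [s s_size unext]] := V_unext (k := r + (n + r)).
  by rewrite addnCA addn_gt0 n_gt0.
have [x0 _] : exists x0 : S, x0 \in s.
  by case: (s) s_size => [/= s0|x0 ? _]; [lia | exists x0; rewrite mem_head].
have [_ [e [_ ee]]] := idempotent_power x0.
exists S => //; pose x (i : 'I_n) := nth x0 s (r + i).
exists (fun o i => if o == Some i then e else x i), (take r s), (drop n (drop r s)).
have s_cat : take r s ++ map x (enum 'I_n) ++ drop n (drop r s) = s.
  have -> : map x (enum 'I_n) = take n (drop r s).
    apply: (@eq_from_nth _ x0) => [|i]; rewrite size_map size_enum_ord.
      by rewrite size_takel // size_drop s_size; lia.
    move=> i_lt; rewrite (nth_map (Ordinal n_gt0)) ?size_enum_ord // nth_take // nth_drop.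
    by rewrite /x nth_enum_ord.
  by rewrite !cat_take_drop.
split; first by rewrite size_takel // s_size leq_addr.
  by rewrite !size_drop s_size; lia.
move=> v eq_v; apply: content_of_unextendable (V_lt VS) ee _ eq_v.
by rewrite s_cat s_size.
Qed.

(** A word [u] with a nonzero interval as value is a factor of [enum 'I_n], say
    [p ++ u ++ q = enum 'I_n].  A word [v] with the same values as [u] in the
    family can replace [u] there, and the family separates [enum 'I_n] from
    all other words, whence [v = u]. *)
Lemma permutation_free_cost n :
  (0 < n)%N ->
  (forall u : seq 'I_n, perm_eq u (enum 'I_n) -> u <> enum 'I_n ->
     exists2 T : finSemigroupType, V T &
       exists x : 'I_n -> T, sprod (map x u) <> sprod (map x (enum 'I_n))) ->
  exists T : finSemigroupType,
    [/\ V T, (#|T| <= (n.+1 ^ 2).+1)%N & (n <= slp_cost_semigroup None T)%N].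
Proof.
move=> n_gt0 no_identity.
have [S VS [x [P [Q [P0 Q0 content]]]]] := content_family 0 n_gt0.
have {}P0 := size0nil P0; have {}Q0 := size0nil Q0; rewrite {}P0 {}Q0 in content.
(* Tuples that are not nontrivial permutations get a dummy member of V. *)
have witness (u : n.-tuple 'I_n) : exists W : {T : finSemigroupType & 'I_n -> T},
    V (projT1 W) /\ (perm_eq u (enum 'I_n) -> u <> enum 'I_n :> seq _ ->
      sprod (map (projT2 W) u) <> sprod (map (projT2 W) (enum 'I_n))).
  have [[u_perm u_neq]|no] := pselect (perm_eq u (enum 'I_n) /\ u <> enum 'I_n :> seq _).
    have [T VT [w w_neq]] := no_identity u u_perm u_neq.
    by exists (existT _ T w).
  by exists (existT (fun T : finSemigroupType => 'I_n -> T) S (x None)); split=> // ? ?; case: no.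
have [W W_neq] := choice witness.
pose F (a : option 'I_n + n.-tuple 'I_n) : {T : finSemigroupType & 'I_n -> T} :=
  match a with inl o => existT _ S (x o) | inr u => W u end.
have VF a : V (projT1 (F a)) by case: a => // u; have [] := W_neq u.
pose t : interval_semigroup n := Some (ord0, ord_max).
(* The zero, and the pairs that avoid the letter i when they are intervals. *)
pose A (i : 'I_n) : {set interval_semigroup n} :=
  [set m : interval_semigroup n | if m is Some (a, b) then (b <= i)%N || (i < a)%N else true]%SET.
rewrite -card_interval_semigroup.
apply: (@pseudovariety_relations_cost V V_pv n _ (fun a => projT1 (F a)) (fun a => projT2 (F a))
  (interval_semigroup n) (@unit_interval n) A t) => //.
- apply: (@relations_of_nonzero n _ _ _ _ _ (None : interval_semigroup n) (inl None)).
  move=> u v rel_uv [[a b]|] // zu _; rewrite -zu; congr (sprod (map _ _)).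
  have [ab u_iota] := unit_intervals_word zu.
  set p := take a (enum 'I_n); set q := drop b (enum 'I_n).
  have puq : p ++ u ++ q = enum 'I_n.
    apply: (inj_map val_inj); rewrite !map_cat u_iota map_take map_drop val_enum_ord.
    rewrite take_iota drop_iota add0n (minn_idPl _); last by rewrite ltnW // (leq_trans ab) // -ltnS.
    have -> : iota a (b - a) ++ iota b (n - b) = iota a (n - a).
      have -> : (n - a = (b - a) + (n - b))%N by have := ltn_ord b; lia.
      by rewrite iotaD subnKC // ltnW.
    have n_cat : (n = a + (n - a))%N by have := ltn_ord a; lia.
    by rewrite [in RHS]n_cat iotaD.
  have eq_pvq c : sprod (map (projT2 (F c)) (p ++ v ++ q)) = sprod (map (projT2 (F c)) (enum 'I_n)).
    by rewrite -puq !map_cat !sprod_cat rel_uv.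
  have pvq_perm : perm_eq (p ++ v ++ q) (enum 'I_n).
    by apply: content => o; rewrite !cats0 !cat0s; apply: (eq_pvq (inl o)).
  have pvq_size : size (p ++ v ++ q) == n by rewrite (perm_size pvq_perm) size_enum_ord.
  have pvq : p ++ v ++ q = enum 'I_n.
    apply: contrapT => pvq_neq.
    by have [_ /(_ pvq_perm pvq_neq)] := W_neq (Tuple pvq_size); apply; apply: (eq_pvq (inr (Tuple pvq_size))).
  move: pvq; rewrite -puq => /eqP; rewrite eqseq_cat // => /andP[_].
  have uv_size : size v = size u.
    have := congr1 size puq; rewrite -(perm_size pvq_perm) !size_cat => /addnI/addIn.
    by move->.
  by rewrite eqseq_cat // => /andP[/eqP-> _].
- have := @unit_intervals_iota n (enum 'I_n) 0 n (leqnn _) n_gt0 (val_enum_ord n).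
  move->; congr (Some (Some (_, _))); by apply: val_inj; rewrite /= inordK.
- move=> i; apply/forall_inP => [[[a b]|]]; last by move=> _; apply/forall_inP => m _; rewrite inE.
  rewrite inE => ab; apply/forall_inP => [[[c d]|]]; last by rewrite !inE.
  rewrite !inE interval_mulE /interval_mul => cd.
  case: (b =P c) => // bc; case/orP: ab => [ab|->]; last by rewrite orbT.
  by case/orP: cd => [->//|]; rewrite -bc ltnNge ab.
- move=> i j ji; rewrite inE /unit_interval !inordK ?ltnS ?(ltnW (ltn_ord j)) //.
  by rewrite -neq_ltn.
- by move=> i; rewrite inE /= negb_or -ltnNge ltn_ord.
Qed.

(** A word [u] without repetition is completed by the missing letters [q] to a
    permutation of all letters.  As letters between [P] and [Q] commute, a word
    [v] with the same values as [u] can replace [u] there, so that [v ++ q] is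
    again a permutation of all letters, and [v] has the letters of [u]. *)
Lemma commutes_inside_cost r n :
  commutes_inside V r -> (0 < n)%N ->
  exists T : finSemigroupType,
    [/\ V T, (#|T| <= (2 ^ n).+1)%N & (n <= slp_cost_semigroup None T)%N].
Proof.
move=> comm n_gt0.
have [S VS [x [P [Q [P_size Q_size content]]]]] := content_family r n_gt0.
pose t : disjoint_union_semigroup n := Some [set: 'I_n]%SET.
pose A (i : 'I_n) : {set disjoint_union_semigroup n} :=
  [set m : disjoint_union_semigroup n | if m is Some B then i \notin B else true]%SET.
rewrite -card_disjoint_union_semigroup.
apply: (@pseudovariety_relations_cost V V_pv n _ (fun=> S) x
  (disjoint_union_semigroup n) (@singleton n) A t) => //.
- apply: (@relations_of_nonzero n _ _ _ _ _ (None : disjoint_union_semigroup n) None).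
  move=> u v rel_uv m zu m_n0.
  have u_n0 : u != [::] by apply: contra_eqN zu => /eqP->.
  have u_uniq : uniq u by move: zu m_n0; rewrite singletons_word //; case: ifP => // _ [<-].
  set q := enum [predC u].
  have uq_perm : perm_eq (u ++ q) (enum 'I_n).
    apply: uniq_perm; rewrite ?enum_uniq // ?cat_uniq ?u_uniq ?enum_uniq ?andbT /=.
      by apply/hasPn => i; rewrite mem_enum.
    by move=> i; rewrite mem_cat !mem_enum inE orbN.
  have vq_perm : perm_eq (v ++ q) (enum 'I_n).
    apply: content => o; rewrite -(commutes_inside_perm (x o) comm VS _ _ uq_perm) ?P_size ?Q_size //.
    by rewrite !map_cat -!catA !(sprod_cat P) !(sprod_cat (map _ _)) rel_uv.
  have uv : perm_eq u v by rewrite -(perm_cat2r q) (perm_trans uq_perm) // perm_sym.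
  have v_n0 : v != [::] by rewrite -size_eq0 -(perm_size uv) size_eq0.
  rewrite -zu !singletons_word // (perm_uniq uv) //.
  have -> // : [set i in u]%SET = [set i in v]%SET.
  by apply/setP => i; rewrite !inE (perm_mem uv).
- rewrite singletons_word ?enum_uniq //; last by rewrite -size_eq0 size_enum_ord -lt0n.
  by congr (Some (Some _)); apply/setP => i; rewrite !inE mem_enum.
- move=> i; apply/forall_inP => [[B|]]; last by move=> _; apply/forall_inP => m _; rewrite inE.
  rewrite inE => iB; apply/forall_inP => [[C|]]; last by rewrite !inE.
  rewrite !inE disjoint_unionE /disjoint_union => iC.
  by case: ifP => // _; rewrite inE negb_or iB.
- by move=> i j ji; rewrite inE /singleton inE eq_sym.
- by move=> i; rewrite inE /= inE.
Qed.

End LowerBound.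

(** * The dichotomy *)

Lemma logarithmic_cost_unless_RB_N (R : realType) (V : finSemigroupType -> Prop) :
  pseudovariety V ->
  ~ (exists2 k, (1 <= k)%N & forall S : finSemigroupType, V S -> RB_N k S) ->
  logarithmic_cost R V None.
Proof.
move=> V_pv not_RB.
have [V_lt|] := pselect (forall S : finSemigroupType, V S -> locally_trivial S); last first.
  move=> /existsNP[S] /not_implyP[VS] /existsNP[e] /existsNP[s] /not_implyP[ee ese].
  apply: (@logarithmic_cost_exponential R V #|S|) => [|n n_gt0]; last first.
    exact: nontrivial_local_monoid_cost ee ese n_gt0.
  rewrite -cardsT; apply/card_gt1P; exists (e * s * e)%g, e; rewrite !inE; split=> //.
  exact/eqP.
have V_unext := unextendable_word V_lt not_RB.
have [identity|no_identity] := pselect (exists n (u : seq 'I_n),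
    [/\ perm_eq u (enum 'I_n), u <> enum 'I_n &
      forall T : finSemigroupType, V T -> forall x : 'I_n -> T,
        sprod (map x u) = sprod (map x (enum 'I_n))]).
  have [n [u [u_perm u_neq u_id]]] := identity.
  have [a [d [b [d_gt0 jump]]]] := jumps_of_permutation_identity u_perm u_neq u_id.
  have [r comm] := commutes_inside_of_jumps d_gt0 jump.
  apply: (@logarithmic_cost_exponential R V 3) => // n' n_gt0.
  have [T [VT T_le cost_ge]] := commutes_inside_cost V_pv V_lt V_unext comm n_gt0.
  exists T; split=> //; apply: leq_trans T_le _.
  by rewrite ltn_exp2r.
apply: (@logarithmic_cost_exponential R V 5) => // n n_gt0.
have [|T [VT T_le cost_ge]] := permutation_free_cost V_pv V_lt V_unext n_gt0.
  move=> u u_perm u_neq; apply: contrapT => no_T; apply: no_identity.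
  exists n, u; split=> // T VT x; apply: contrapT => x_neq; apply: no_T.
  by exists T => //; exists x.
exists T; split=> //; apply: leq_trans T_le _; elim: n n_gt0 {VT cost_ge no_identity} => // [[|n] IHn] _ //.
by have := IHn isT; rewrite !expnS !expn0; lia.
Qed.

Theorem theorem12 (R : realType) (V : finSemigroupType -> Prop)
    (V_pseudovariety : pseudovariety V) :
  [/\ (bounded_diameter V /\ ~ logarithmic_cost R V None) \/
        (~ bounded_diameter V /\ logarithmic_cost R V None),
      bounded_diameter V -> constant_cost R V (Some 2) &
      bounded_diameter V <->
        exists2 k : nat, (1 <= k)%N & forall S : finSemigroupType, V S -> RB_N k S].
Proof.
have bounded_not_log : bounded_diameter V -> ~ logarithmic_cost R V None.
  move=> /(bounded_diameter_cost V_pseudovariety)[b cost_le].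
  by apply: (@not_logarithmic_cost_bounded R V b) => N; apply: cost_le.
have RB_bounded : (exists2 k : nat, (1 <= k)%N & forall S : finSemigroupType, V S -> RB_N k S) ->
    bounded_diameter V by case=> k; apply: bounded_diameter_RB_N.
have log_unless := @logarithmic_cost_unless_RB_N R V V_pseudovariety.
split.
- have [/RB_bounded|/log_unless] := pselect (exists2 k : nat, (1 <= k)%N & forall S : finSemigroupType, V S -> RB_N k S).
    by move=> bounded; left; split=> //; apply: bounded_not_log.
  by move=> log; right; split=> // /bounded_not_log.
- move=> /(bounded_diameter_cost V_pseudovariety)[b cost_le].
  by apply: (@constant_cost_bounded R V _ b); apply: cost_le.
- split=> // /bounded_not_log not_log; apply: contrapT => /log_unless; exact: not_log.
Qed.
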